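(* Let $V$ be a finite-dimensional real vector space, $\eta\in\wedge^2V^*$ of rank $k$, $K=\ker(\eta^\sharp)$, $G\subset V$ a subspace with $V=K\oplus G$, and $Z\in\wedge^2G$ the bivector determined by $Z^\sharp=-(\eta|_G^\sharp)^{-1}\colon G^*\to G$. Let $r\colon\wedge^2V^*\to\wedge^2K^*$ be the restriction map, so $\ker(r)=(K^*\otimes G^* )\oplus\wedge^2G^*$. (i) Let $\beta\in\mathcal{I}_Z$. Then $\exp_\eta(\beta)$ lies in $(\wedge^2V^* )_k$ if, and only if, $\beta$ lies in $\ker(r)=(K^*\otimes G^* )\oplus\wedge^2G^*$. (ii) Let $\beta=(\mu,\sigma)\in\mathcal{I}_Z\cap\big((K^*\otimes G^* )\oplus\wedge^2G^*\big)$. Then $\exp_\eta(\beta)$ is the unique skew-symmetric bilinear form on $V$ with the following properties: its restriction to $G$ equals $(\eta+F(\sigma))|_{\wedge^2G}$; and its kernel is the graph of the map $Z^\sharp\mu^\sharp=-(\eta|_G^\sharp)^{-1}\mu^\sharp\colon K\to G$. (iii) The map $\exp_\eta\colon\mathcal{I}_Z\to\wedge^2V^*$ restricts to a diffeomorphism $$\mathcal{I}_Z\cap\big((K^*\otimes G^* )\oplus\wedge^2G^*\big)\;\stackrel{\cong}{\longrightarrow}\;\{\eta'\in(\wedge^2V^* )_k:\ \ker(\eta')\text{ is transverse to }G\}$$ onto an open neighborhood of $\eta$ in $(\wedge^2V^* )_k$.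
   Context: For $\beta\in\wedge^2V^*$, $\beta^\sharp\colon V\to V^*$, $v\mapsto\iota_v\beta=\beta(v,\cdot)$; the rank of $\beta$ is the rank of $\beta^\sharp$, and $\ker(\beta)=\ker(\beta^\sharp)$. $(\wedge^2V^* )_k$ is the set of elements of $\wedge^2V^*$ of rank $k$. For $Z\in\wedge^2V$, $Z^\sharp\colon V^*\to V$, $\xi\mapsto Z(\xi,\cdot)$. $\mathcal{I}_Z\subset\wedge^2V^*$ is the open set of those $\beta$ such that $\mathrm{id}+Z^\sharp\beta^\sharp\colon V\to V$ is invertible. $F\colon\mathcal{I}_Z\to\wedge^2V^*$ is determined by $(F(\beta))^\sharp=\beta^\sharp(\mathrm{id}+Z^\sharp\beta^\sharp)^{-1}$. The Dirac exponential map is $\exp_\eta\colon\mathcal{I}_Z\to\wedge^2V^*$, $\beta\mapsto\eta+F(\beta)$. For $\mu\in K^*\otimes G^*\subset\wedge^2V^*$, $\mu^\sharp\colon K\to G^*$ is $X\mapsto\iota_X\mu$. $K^*$ and $G^*$ are regarded as subspaces of $V^*$ via $V=K\oplus G$. $\ker(\eta')$ transverse to $G$ means $V=\ker(\eta')\oplus G$ (for $\eta'$ of rank $k=\dim G$). *)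

(* Defs.v *)
From HB Require Import structures.
From mathcomp Require Import all_boot all_order all_algebra.
From mathcomp Require Import all_classical all_reals all_analysis.
Set Implicit Arguments.
Unset Strict Implicit.
Unset Printing Implicit Defensive.
Import Order.TTheory GRing.Theory Num.Theory.
Import numFieldNormedType.Exports.
Local Open Scope classical_set_scope.
Local Open Scope ring_scope.

Definition dual (R : realType) (V : vectType R) : vectType R := 'Hom(V, R^o).

(* A bilinear form b is stored in curried form u |-> b(u, -), so that the    *)
(* flat map b^# of b is b itself, read as a linear map from V to its dual.   *)
Definition bilform (R : realType) (V : vectType R) : vectType R :=
  'Hom(V, dual V).

Definition dual_map (R : realType) (V W : vectType R) (f : 'Hom(V, W)) :
    'Hom(dual W, dual V) :=
  linfun (fun xi : dual W => (xi \o f)%VF : dual V).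

(* (wedge a b)(u, v) = a(u) b(v) - b(u) a(v), see wedgeE.                    *)
Definition wedge (R : realType) (V : vectType R) (a b : dual V) : bilform V :=
  linfun (fun u : V => (a u : R) *: b - (b u : R) *: a : dual V).

Definition skew_form (R : realType) (V : vectType R) : set (bilform V) :=
  [set b : bilform V | forall u v, b u v = - b v u].

(* (wedge^2 V^* )_k                                                          *)
Definition skew_rank (R : realType) (V : vectType R) (k : nat) :
    set (bilform V) :=
  [set b : bilform V | skew_form b /\ \dim (limg b) = k].

Definition vs_incl (R : realType) (V : vectType R) (U : {vspace V}) :
    'Hom(subvs_of U, V) :=
  linfun (vsval : subvs_of U -> V).

Definition restr (R : realType) (V : vectType R) (U : {vspace V})
    (b : bilform V) : bilform (subvs_of U) :=
  (dual_map (vs_incl U) \o b \o vs_incl U)%VF.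

Definition ker_restr (R : realType) (V : vectType R) (U : {vspace V}) :
    set (bilform V) :=
  [set b : bilform V | skew_form b /\ restr U b = 0].

Definition complementary (R : realType) (V : vectType R) (U W : {vspace V}) :=
  (U + W = fullv)%VS /\ (U :&: W = 0)%VS.

(* If V = U (+) W, this is U^* as a subspace of V^*: the functionals         *)
(* obtained by composition with the projection onto U along W.               *)
Definition dual_sub (R : realType) (V : vectType R) (U W : {vspace V}) :
    {vspace dual V} :=
  limg (dual_map (daddv_pi U W)).

(* Span of the a /\ b with a \in A and b \in B: this is wedge^2 A when   *)
(* A = B, and the image of A (x) B in wedge^2 V^* when A and B are           *)
(* independent.                                                              *)
Definition wedgev (R : realType) (V : vectType R) (A B : {vspace dual V}) :
    {vspace bilform V} :=
  (<< [seq wedge a b | a <- vbasis A, b <- vbasis B] >>)%VS.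

Definition graph_of (R : realType) (V : vectType R) (U : {vspace V})
    (f : V -> V) : set V :=
  [set u + f u | u in [set` U]].

(* A bivector Z on V is represented by Z^# : V^* -> V, xi |-> Z(xi, -). In   *)
(* these terms, this is the inclusion of wedge^2 U in wedge^2 V.             *)
Definition bivector_incl (R : realType) (V : vectType R) (U : {vspace V})
    (Z : 'Hom(dual (subvs_of U), subvs_of U)) : 'Hom(dual V, V) :=
  (vs_incl U \o Z \o dual_map (vs_incl U))%VF.

Definition Idom (R : realType) (V : vectType R) (Z : 'Hom(dual V, V)) :
    set (bilform V) :=
  [set b : bilform V | skew_form b /\ bijective (\1 + (Z \o b))%VF].

(* Meaningful on Idom Z, where inv_lfun is the true inverse.                 *)
Definition Fmap (R : realType) (V : vectType R) (Z : 'Hom(dual V, V))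
    (b : bilform V) : bilform V :=
  (b \o (\1 + (Z \o b))^-1)%VF.

Definition dirac_exp (R : realType) (V : vectType R) (Z : 'Hom(dual V, V))
    (eta b : bilform V) : bilform V :=
  eta + Fmap Z b.

(* A vectType carries no topology of its own; its standard topology and    *)
(* smooth structure are those of the coordinates in a basis. They do not   *)
(* depend on the basis, and vbasis fullv is used throughout.               *)
Definition coords (R : realType) (E : vectType R) : E -> 'rV[R]_(\dim {:E}) :=
  passmx.rVof (vbasis {:E}).

Definition of_coords (R : realType) (E : vectType R) :
    'rV[R]_(\dim {:E}) -> E :=
  passmx.vecof (vbasis {:E}).

Fixpoint Ck (R : realType) (m n : nat) (k : nat) (U : set 'rV[R]_m)
    (f : 'rV[R]_m -> 'rV[R]_n) {struct k} : Prop :=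
  if k is k'.+1 then
    (forall x, U x -> differentiable f x) /\
    (forall v, Ck k' U (fun x => 'd f x v))
  else forall x, U x -> {for x, continuous f}.

Definition vopen (R : realType) (E : vectType R) (U : set E) : Prop :=
  open (@coords R E @` U).

Definition smooth_open (R : realType) (E F : vectType R) (U : set E)
    (f : E -> F) : Prop :=
  forall k, Ck k (@coords R E @` U) (@coords R F \o f \o @of_coords R E).

(* Local smooth extendability; for embedded submanifolds A this is the usual *)
(* smoothness of the restriction of f to A.                                  *)
Definition smooth_on (R : realType) (E F : vectType R) (A : set E)
    (f : E -> F) : Prop :=
  forall x, A x -> exists (U : set E) (g : E -> F),
    [/\ vopen U, U x, smooth_open U g & forall y, A y -> U y -> f y = g y].

Definition diffeomorphism (R : realType) (E F : vectType R) (A : set E)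
    (B : set F) (f : E -> F) : Prop :=
  [/\ set_bij A B f, smooth_on A f &
      exists2 g : F -> E, (forall x, A x -> g (f x) = x) & smooth_on B g].

Lemma dual_mapE (R : realType) (V W : vectType R) (f : 'Hom(V, W))
    (xi : dual W) (v : V) : dual_map f xi v = xi (f v).
Proof.
have lin : linear (fun xi : dual W => (xi \o f)%VF : dual V).
  by move=> a x y; rewrite comp_lfunDl comp_lfunZl.
pose aux := GRing.isLinear.Build _ _ _ _ _ lin.
pose F : {linear dual W -> dual V} :=
  HB.pack (fun xi : dual W => (xi \o f)%VF : dual V) aux.
by rewrite /dual_map (lfunE F) /= comp_lfunE.
Qed.

Lemma wedgeE (R : realType) (V : vectType R) (a b : dual V) (u v : V) :
  wedge a b u v = (a u : R) * (b v : R) - (b u : R) * (a v : R).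
Proof.
have lin : linear (fun u : V => (a u : R) *: b - (b u : R) *: a : dual V).
  move=> c x y; rewrite [a _]linearP [b _]linearP !scalerDl.
  by rewrite -!scalerA scalerBr opprD addrACA.
pose aux := GRing.isLinear.Build _ _ _ _ _ lin.
pose F : {linear V -> dual V} :=
  HB.pack (fun u : V => (a u : R) *: b - (b u : R) *: a : dual V) aux.
by rewrite /wedge (lfunE F) /= add_lfunE opp_lfunE !scale_lfunE.
Qed.

Lemma restrE (R : realType) (V : vectType R) (U : {vspace V})
    (b : bilform V) (u v : subvs_of U) :
  restr U b u v = b (vsval u) (vsval v).
Proof. by rewrite /restr !comp_lfunE dual_mapE !lfunE. Qed.

(* Main.v *)
Require Import Defs.
From HB Require Import structures.
From mathcomp Require Import all_boot all_order all_algebra.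
From mathcomp Require Import all_classical all_reals all_analysis.
From mathcomp Require Import ring.
Import GRing.Theory numFieldNormedType.Exports.
Local Open Scope classical_set_scope.
Local Open Scope ring_scope.

(** Write P and Q for the projections of V = K + G onto K and G, and A for
    id + Z beta, the map whose invertibility defines the domain I_Z.  Everything
    about exp_eta rests on one identity, [dirac_exp_shear]:
      exp_eta(beta)(A u, v) = eta(u, v) + beta(u, P v).
    It holds because Z inverts - eta on G, so that eta (Z xi) = - xi Q.

    Read at a fixed u, the right-hand side vanishes for all v exactly when u
    lies in K and beta(u, -) vanishes on K.  Hence ker (exp_eta beta) is the
    image under A of the kernel of the restriction of beta to K
    ([ker_dirac_exp]).  The rank is that of eta iff this kernel is all of K,
    i.e. iff r(beta) = 0: this is (i).  In that case
    ker (exp_eta beta) = A(K), and for beta = (mu, sigma) the form sigma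
    vanishes on K, so that A(K) is the graph of Z mu over K.  A skew form is
    determined by its kernel and its values on a complement of it
    ([skew_form_eq]), whence (ii).

    For (iii), the inverse of F = F_Z is F_{-Z} ([Fmap_inverse]), so the
    inverse of exp_eta is eta' |-> F_{-Z}(eta' - eta), defined where
    id - Z (eta' - eta) is invertible.  Since Z eta = - Q, that map is
    P - Z eta', which is invertible iff eta' is nondegenerate on G; for forms
    of rank k this says that ker eta' is transverse to G
    ([nondegenerate_shear], [transverse_nondegenerate]).  This gives at once
    the image of exp_eta and its openness in the forms of rank k.

    Smoothness of exp_eta and of its inverse is a statement about rational
    functions: in coordinates both maps have entries built from the coordinates
    by sums, products and the inverse of a nonvanishing determinant.  This class
    of functions is stable under directional derivatives
    ([rational_differentiable]), hence consists of functions of class C^k for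
    all k ([rational_mx_Ck]). *)
(** * Bilinear forms on a direct sum *)

Section Decomposition.
Set Implicit Arguments.
Unset Strict Implicit.
Variables (R : realType) (V : vectType R).
Implicit Types (U W : {vspace V}) (b : bilform V) (a : dual V).

Lemma complementaryC U W : complementary U W -> complementary W U.
Proof.
by case=> sUW cUW; split; rewrite ?[(W + U)%VS]addvC ?[(W :&: U)%VS]capvC.
Qed.

Lemma complementary_proj U W u : complementary U W ->
  u = daddv_pi U W u + daddv_pi W U u.
Proof. by case=> sUW cUW; rewrite daddv_pi_add ?sUW ?memvf. Qed.

Lemma complementary_cap0 U W u :
  complementary U W -> u \in U -> u \in W -> u = 0.
Proof.
by case=> _ cUW uU uW; apply/eqP; rewrite -memv0 -cUW memv_cap uU.
Qed.

Lemma complementary_pi0 U W w : complementary U W -> w \in W ->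
  daddv_pi U W w = 0.
Proof.
move=> cUW wW; have := complementary_proj w cUW.
rewrite (daddv_pi_id (complementaryC cUW).2 wW) => /esym/eqP.
by rewrite -subr_eq0 addrK => /eqP.
Qed.

Lemma bijective_lfunP (f : 'Hom(V, V)) : bijective f <-> lker f == 0%VS.
Proof.
split=> [/bij_inj fI|f0]; first exact/lker0P.
by exists (f^-1%VF); [exact: lker0_lfunK|exact: lker0_lfunVK].
Qed.

Lemma bijective_lker b (Z : 'Hom(dual V, V)) :
  bijective (\1 + (Z \o b))%VF <-> (forall u, u + Z (b u) = 0 -> u = 0).
Proof.
rewrite bijective_lfunP; split=> [/lker0P fI u u0|f0].
  by apply: fI; rewrite linear0 add_lfunE id_lfunE comp_lfunE.
apply/lker0P => u v /eqP; rewrite -subr_eq0 -linearB /= => /eqP.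
rewrite add_lfunE id_lfunE comp_lfunE => /f0/eqP.
by rewrite subr_eq0 => /eqP.
Qed.

(** Lets predicates that are not given by a subspace, such as skew-symmetry, be
    checked on generators only. *)
Lemma span_ind (E : vectType R) (X : seq E) (P : E -> Prop) :
  P 0 -> (forall c x y, P x -> P y -> P (c *: x + y)) ->
  (forall x, x \in X -> P x) -> forall x, x \in <<X>>%VS -> P x.
Proof.
move=> P0 PD PX x xX; rewrite (coord_span (X := in_tuple X) xX).
elim/big_rec: _ => // i y _ Py; apply: PD => //.
by apply: PX; rewrite mem_nth.
Qed.

Lemma wedgeDl c a a' (a2 : dual V) :
  wedge (c *: a + a') a2 = c *: wedge a a2 + wedge a' a2.
Proof.
apply/lfunP => u; apply/lfunP => v.
rewrite !(add_lfunE, scale_lfunE, wedgeE) /=.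
rewrite -![c *: _]/(c * _ : R). ring.
Qed.

Lemma wedgeC a a' : wedge a a' = - wedge a' a.
Proof.
apply/lfunP => u; apply/lfunP => v.
by rewrite !(opp_lfunE, wedgeE) opprB.
Qed.

Lemma wedgeDr c a a' (a2 : dual V) :
  wedge a2 (c *: a + a') = c *: wedge a2 a + wedge a2 a'.
Proof. by rewrite wedgeC wedgeDl opprD -scalerN -!wedgeC. Qed.

Lemma wedge_wedgev (A B : {vspace dual V}) a a' :
  a \in A -> a' \in B -> wedge a a' \in wedgev A B.
Proof.
have w0l (x : dual V) : wedge 0 x = 0.
  by have := wedgeDl (-1) 0 0 x; rewrite scaler0 addr0 scaleN1r addNr.
have w0r (x : dual V) : wedge x 0 = 0 by rewrite wedgeC w0l oppr0.
rewrite -{1}(span_basis (vbasisP A)) -{1}(span_basis (vbasisP B)) => aA aB.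
elim/span_ind: _ / aA => [|c x y xW yW|x xA]; first by rewrite w0l mem0v.
  by rewrite wedgeDl memvD ?memvZ.
elim/span_ind: _ / aB => [|c y z yW zW|y yB]; first by rewrite w0r mem0v.
  by rewrite wedgeDr memvD ?memvZ.
by apply: memv_span; apply/allpairsP; exists (x, y).
Qed.

Lemma wedgev_ind (A B : {vspace dual V}) (P : bilform V -> Prop) :
  P 0 -> (forall c x y, P x -> P y -> P (c *: x + y)) ->
  (forall a a', a \in A -> a' \in B -> P (wedge a a')) ->
  forall b, b \in wedgev A B -> P b.
Proof.
move=> P0 PD Pw b; apply: span_ind => // _ /allpairsP[[a a'] /= [aA a'B ->]].
by apply: Pw; exact: vbasis_mem.
Qed.

Lemma dual_sub_comp U W a : (a \o daddv_pi U W)%VF \in dual_sub U W.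
Proof.
have -> : (a \o daddv_pi U W)%VF = dual_map (daddv_pi U W) a.
  by apply/lfunP => v; rewrite dual_mapE comp_lfunE.
exact: memv_img (memvf _).
Qed.

Lemma dual_sub0 U W a w : complementary U W -> a \in dual_sub U W ->
  w \in W -> a w = 0.
Proof.
move=> cUW /memv_imgP[xi _ ->] wW.
by rewrite dual_mapE complementary_pi0 // linear0.
Qed.

Definition dual_coord (i : 'I_(\dim {:V})) : dual V :=
  linfun (coord (vbasis {:V}) i : V -> R^o).

(** With b(u, v) = sum_i e_i^*(u) b(e_i, v) in a basis (e_i), the left-hand side
    is a sum of decomposable forms that antisymmetrizes (u, v) |-> b(f u, g v);
    choosing for f and g the projections of a direct sum puts the factors in the
    wanted subspaces of V^*. *)
Lemma sum_wedgeE b (f g : 'Hom(V, V)) u v :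
  (\sum_i wedge (dual_coord i \o f)%VF (b (vbasis {:V})`_i \o g)%VF
     : bilform V) u v
  = b (f u) (g v) - b (f v) (g u).
Proof.
have bE x y :
    b x y = \sum_i coord (vbasis {:V}) i x * (b (vbasis {:V})`_i y : R).
  rewrite {1}(coord_vbasis (memvf x)) linear_sum sum_lfunE.
  by apply: eq_bigr => i _; rewrite linearZ scale_lfunE.
rewrite sum_lfunE sum_lfunE !bE -sumrB; apply: eq_bigr => i _.
rewrite wedgeE !comp_lfunE !lfunE /=; congr (_ - _); exact: mulrC.
Qed.

End Decomposition.

Section SkewForms.
Set Implicit Arguments.
Unset Strict Implicit.
Variables (R : realType) (V : vectType R) (K G : {vspace V}).
Hypothesis cKG : complementary K G.
Implicit Types (b : bilform V).

Let KG := wedgev (dual_sub K G) (dual_sub G K).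
Let GG := wedgev (dual_sub G K) (dual_sub G K).

Lemma skew_wedge (a a' : dual V) : skew_form (wedge a a').
Proof.
by move=> u v; rewrite !wedgeE opprB [in RHS]mulrC [X in _ - X = _]mulrC.
Qed.

Lemma skew_lin c b b' : skew_form b -> skew_form b' -> skew_form (c *: b + b').
Proof.
move=> sb sb' u v; rewrite !(add_lfunE, scale_lfunE) sb sb' scalerN.
by rewrite -opprD.
Qed.

Lemma skew0 : skew_form (0 : bilform V).
Proof. by move=> u v; rewrite !zero_lfunE oppr0. Qed.

Lemma KG_vanish b : b \in KG ->
  skew_form b /\ (forall g g', g \in G -> g' \in G -> b g g' = 0) /\
  (forall k k', k \in K -> k' \in K -> b k k' = 0).
Proof.
elim/wedgev_ind => {b} [|c b b' [sb [bG bK]] [sb' [bG' bK']]|a a' aK a'G].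
- by split; [exact: skew0|split=> *; rewrite !zero_lfunE].
- split; first exact: skew_lin.
  split=> x y xU yU; rewrite !(add_lfunE, scale_lfunE).
    by rewrite bG // bG' // addr0; exact: mulr0.
  by rewrite bK // bK' // addr0; exact: mulr0.
split; first exact: skew_wedge.
split=> x y xU yU; rewrite wedgeE.
  by rewrite !(dual_sub0 cKG aK) // mul0r mulr0 subrr.
by rewrite !(dual_sub0 (complementaryC cKG) a'G) // mul0r mulr0 subrr.
Qed.

Lemma GG_vanish b : b \in GG ->
  skew_form b /\ (forall k, k \in K -> b k = 0).
Proof.
elim/wedgev_ind => {b} [|c b b' [sb bK] [sb' bK']|a a' aG a'G].
- by split; [exact: skew0|move=> k _; rewrite zero_lfunE].
- split; first exact: skew_lin.
  by move=> k kK; rewrite !(add_lfunE, scale_lfunE) bK // bK' // scaler0 addr0.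
split; first exact: skew_wedge.
move=> k kK; apply/lfunP => v; rewrite wedgeE zero_lfunE.
by rewrite !(dual_sub0 (complementaryC cKG) _ kK) // !mul0r subrr.
Qed.

Lemma directv_KG_GG : directv (KG + GG).
Proof.
apply/directv_addP/eqP; rewrite -subv0; apply/subvP => b.
rewrite memv_cap memv0 => /andP[/KG_vanish[sb [bG _]] /GG_vanish[_ bK]].
apply/eqP/lfunP => u; apply/lfunP => v; rewrite !zero_lfunE.
rewrite (complementary_proj u cKG) linearD /= add_lfunE bK ?memv_pi //.
rewrite zero_lfunE add0r.
rewrite (complementary_proj v cKG) linearD /= [X in _ + X]bG ?memv_pi // addr0.
by rewrite sb bK ?memv_pi // zero_lfunE oppr0.
Qed.

Lemma ker_restrP b : ker_restr K b <->
  skew_form b /\ forall k k', k \in K -> k' \in K -> b k k' = 0.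
Proof.
split=> -[sb bK]; split=> //.
  move=> k k' kK k'K; have := restrE b (Subvs kK) (Subvs k'K).
  by rewrite bK !zero_lfunE /= => <-.
apply/lfunP => u; apply/lfunP => v.
by rewrite restrE bK ?subvsP // !zero_lfunE.
Qed.

(** A skew form b without K-K part is b(Pu, Qv) + b(Qu, Pv) + b(Qu, Qv); the
    first two terms are the antisymmetrization of b(P -, Q -), and the last one
    is half that of b(Q -, Q -). *)
Lemma ker_restr_KG_GG : ker_restr K = [set` (KG + GG)%VS].
Proof.
apply/seteqP; split=> b /=; last first.
  move=> /memv_addP[m /KG_vanish[sm [_ mK]] [s /GG_vanish[ss sK] ->]].
  apply/ker_restrP; split=> [u v|k k' kK k'K].
    by rewrite !add_lfunE sm ss opprD.
  by rewrite !add_lfunE mK // sK // zero_lfunE addr0.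
move/ker_restrP => [sb bK].
pose P := daddv_pi K G; pose Q := daddv_pi G K.
(* m and s are the K-G component of b and twice its G-G component. *)
pose m : bilform V :=
  \sum_i wedge (dual_coord i \o P)%VF (b (vbasis {:V})`_i \o Q)%VF.
pose s : bilform V :=
  \sum_i wedge (dual_coord i \o Q)%VF (b (vbasis {:V})`_i \o Q)%VF.
have -> : b = m + 2^-1 *: s.
  apply/lfunP => u; apply/lfunP => v.
  rewrite !add_lfunE !scale_lfunE !sum_wedgeE -/P -/Q.
  rewrite {1}(complementary_proj u cKG) {1}(complementary_proj v cKG) -/P -/Q.
  rewrite !linearD /= !add_lfunE [b (P u) (P v)]bK ?memv_pi // add0r.
  rewrite [b (P v) _]sb [b (Q v) (Q u)]sb !opprK -[_ *: _]/(_ * _ : R).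
  by field.
apply: memv_add; last apply: memvZ.
  by apply: memv_suml => i _; apply: wedge_wedgev; exact: dual_sub_comp.
by apply: memv_suml => i _; apply: wedge_wedgev; exact: dual_sub_comp.
Qed.

End SkewForms.

(** * The Dirac exponential *)

Section DiracExponential.
Set Implicit Arguments.
Unset Strict Implicit.
Variables (R : realType) (V : vectType R).

(** Defining property of F(b): it takes A u to b u, where A = id + Z b.  Used
    instead of the inverse itself throughout. *)
Lemma Fmap_apply (Z : 'Hom(dual V, V)) (b : bilform V) u :
  bijective (\1 + (Z \o b))%VF -> Fmap Z b (u + Z (b u)) = b u.
Proof.
move/bijective_lfunP => f0.
have := lker0_lfunK f0 u; rewrite add_lfunE id_lfunE comp_lfunE => fK.
by rewrite /Fmap comp_lfunE fK.
Qed.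

Lemma shear_surj (Z : 'Hom(dual V, V)) (b : bilform V) v :
  bijective (\1 + (Z \o b))%VF -> exists u, v = u + Z (b u).
Proof.
case=> g _ gK; exists (g v); rewrite -{1}[v]gK.
by rewrite add_lfunE id_lfunE comp_lfunE.
Qed.

(** With alpha = F_Z(b) and A = id + Z b one has alpha A = b, so
    (id - Z alpha) A = A - Z b = id; thus id - Z alpha = A^-1 and
    F_{-Z}(alpha) = alpha A = b. *)
Lemma Fmap_inverse (Z : 'Hom(dual V, V)) (b : bilform V) :
  bijective (\1 + (Z \o b))%VF ->
  bijective (\1 + (- Z \o Fmap Z b))%VF /\ Fmap (- Z) (Fmap Z b) = b.
Proof.
move=> bij.
have bij' : bijective (\1 + (- Z \o Fmap Z b))%VF.
  apply/bijective_lker => v; have [u ->] := shear_surj v bij.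
  by rewrite Fmap_apply // (opp_lfunE Z) addrK => ->; rewrite !linear0 addr0.
split=> //; apply/lfunP => u.
have := Fmap_apply (u + Z (b u)) bij'.
by rewrite (Fmap_apply u bij) (opp_lfunE Z) addrK.
Qed.

(** For A = id + Z b, F(b)(A u, A v) = b(u, v) + b(u, Z (b v)), and each term
    is skew in (u, v). *)
Lemma Fmap_skew (Z : 'Hom(dual V, V)) (b : bilform V) :
  (forall xi zeta : dual V, xi (Z zeta) = - zeta (Z xi)) ->
  bijective (\1 + (Z \o b))%VF -> skew_form b -> skew_form (Fmap Z b).
Proof.
move=> sZ bij sb x y.
have [u ->] := shear_surj x bij; have [v ->] := shear_surj y bij.
by rewrite !Fmap_apply // !linearD /= sb (sZ (b u)) -opprD.
Qed.

Variables (eta : bilform V) (K G : {vspace V}) (Z : 'Hom(dual V, V)).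
Hypothesis sketa : skew_form eta.
Hypothesis kerK : K = lker eta.
Hypothesis cKG : complementary K G.
Local Notation P := (daddv_pi K G).
Local Notation Q := (daddv_pi G K).

Definition nondegenerate_on (U : {vspace V}) (b : bilform V) :=
  forall u, u \in U -> (forall v, v \in U -> b u v = 0) -> u = 0.

Lemma eta_ker u v : u \in K -> eta u v = 0.
Proof. by rewrite kerK memv_ker => /eqP->; rewrite zero_lfunE. Qed.

(** An element of W pairing to zero with W also pairs to zero with the kernel,
    hence lies in it. *)
Lemma complement_nondegenerate (b : bilform V) (U W : {vspace V}) :
  skew_form b -> U = lker b -> complementary U W -> nondegenerate_on W b.
Proof.
move=> sb -> cUW g gW bg; apply: (complementary_cap0 cUW) => //.
rewrite memv_ker; apply/eqP/lfunP => v; rewrite zero_lfunE.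
rewrite (complementary_proj v cUW) linearD /= [X in _ + X]bg ?memv_pi //.
rewrite addr0 sb.
have := memv_pi (lker b) W v; rewrite memv_ker => /eqP->.
by rewrite zero_lfunE oppr0.
Qed.

(** These two properties characterize Z and are all that is used of it below.
    They hold since the restriction of eta to G is injective from G to G^*,
    hence bijective by equality of dimensions. *)
Lemma bivector_of_restr :
  Z = bivector_incl (- (restr G eta)^-1%VF) ->
  (forall xi, Z xi \in G) /\ (forall xi g, g \in G -> eta (Z xi) g = - xi g).
Proof.
have ndG := complement_nondegenerate sketa kerK cKG.
move=> ->; split=> xi.
  by rewrite /bivector_incl !comp_lfunE lfunE subvsP.
move=> g gG; rewrite /bivector_incl !comp_lfunE lfunE /= opp_lfunE.
set f := restr G eta; set x := dual_map _ xi.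
have f0 : lker f == 0%VS.
  apply/lker0P => u v fuv; apply/eqP; rewrite -subr_eq0; apply/eqP.
  apply: val_inj; apply: (ndG (vsval (u - v))); first exact: subvsP.
  move=> w wG; have := restrE eta (u - v) (Subvs wG).
  by rewrite linearB /= -/f fuv subrr zero_lfunE => <-.
have fT : limg f = fullv.
  apply/eqP; rewrite eqEdim subvf limg_dim_eq; last by rewrite (eqP f0) capv0.
  by rewrite !dimvf /= /dim /= muln1.
have xf : x \in limg f by rewrite fT memvf.
have := restrE eta (- (f^-1)%VF x) (Subvs gG).
rewrite -/f linearN /= opp_lfunE limg_lfunVK //= => <-.
by rewrite dual_mapE lfunE.
Qed.

Hypothesis ZG : forall xi, Z xi \in G.
Hypothesis etaZ : forall xi g, g \in G -> eta (Z xi) g = - xi g.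

Lemma nondegenerate_eta : nondegenerate_on G eta.
Proof. exact: complement_nondegenerate sketa kerK cKG. Qed.

Lemma eta_Z (xi : dual V) v : eta (Z xi) v = - xi (Q v).
Proof.
rewrite {1}(complementary_proj v cKG) linearD /= [X in _ + X]etaZ ?memv_pi //.
by rewrite sketa eta_ker ?memv_pi // oppr0 add0r.
Qed.

Lemma Z_eq0 (xi : dual V) : (forall g, g \in G -> xi g = 0) -> Z xi = 0.
Proof.
by move=> xi0; apply: nondegenerate_eta => // g gG; rewrite etaZ // xi0 ?oppr0.
Qed.

Lemma Z_eta u : Z (eta u) = - Q u.
Proof.
apply/eqP; rewrite -subr_eq0 opprK; apply/eqP; apply: nondegenerate_eta.
  by rewrite memvD ?memv_pi.
move=> g gG; rewrite linearD /= add_lfunE etaZ //.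
rewrite {1}(complementary_proj u cKG) linearD /= add_lfunE.
by rewrite eta_ker ?memv_pi // add0r addNr.
Qed.

Lemma Z_skew (xi zeta : dual V) : xi (Z zeta) = - zeta (Z xi).
Proof. by rewrite -etaZ // sketa etaZ // opprK. Qed.

(** Add eta (u + Z (b u)) = eta u - (b u) Q to F(b)(u + Z (b u)) = b u, and
    use id - Q = P. *)
Lemma dirac_exp_shear (b : bilform V) u v : bijective (\1 + (Z \o b))%VF ->
  dirac_exp Z eta b (u + Z (b u)) v = eta u v + b u (P v).
Proof.
move=> bij; rewrite /dirac_exp add_lfunE Fmap_apply // linearD /=.
have bE : b u v = b u (P v) + b u (Q v).
  by rewrite {1}(complementary_proj v cKG) linearD.
rewrite !add_lfunE eta_Z [X in _ + X]bE.
by rewrite addrACA addNr addr0.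
Qed.

Lemma dirac_exp_skew (b : bilform V) :
  Idom Z b -> skew_form (dirac_exp Z eta b).
Proof.
case=> sb bij u v; rewrite !add_lfunE sketa (Fmap_skew Z_skew bij sb) //.
by rewrite -opprD.
Qed.

(** In [dirac_exp_shear], taking v in G leaves eta(u, v), whose vanishing puts
    u in K by nondegeneracy on G; then taking v in K leaves b(u, v). *)
Lemma ker_dirac_exp (b : bilform V) u : bijective (\1 + (Z \o b))%VF ->
  u + Z (b u) \in lker (dirac_exp Z eta b) <->
  u \in K /\ forall k, k \in K -> b u k = 0.
Proof.
move=> bij; rewrite memv_ker; split=> [/eqP e0|[uK bu]].
  have euv v : eta u v + b u (P v) = 0.
    by rewrite -dirac_exp_shear // e0 zero_lfunE.
  have Qu0 : Q u = 0.
    apply: nondegenerate_eta; first exact: memv_pi.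
    move=> g gG; have := euv g; rewrite complementary_pi0 // linear0 addr0.
    rewrite {1}(complementary_proj u cKG) linearD /= add_lfunE.
    by rewrite eta_ker ?memv_pi // add0r.
  have uK : u \in K by rewrite (complementary_proj u cKG) Qu0 addr0 memv_pi.
  split=> // k kK; have := euv k; rewrite eta_ker // add0r.
  by rewrite (daddv_pi_id cKG.2 kK).
apply/eqP/lfunP => v.
by rewrite dirac_exp_shear // eta_ker // bu ?memv_pi // addr0 zero_lfunE.
Qed.

Lemma ker_dirac_expE (b : bilform V) : bijective (\1 + (Z \o b))%VF ->
  (forall k k', k \in K -> k' \in K -> b k k' = 0) ->
  lker (dirac_exp Z eta b) = ((\1 + (Z \o b))%VF @: K)%VS.
Proof.
move=> bij bK; apply/vspaceP => x; have [u ->] := shear_surj x bij.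
have fE w : w + Z (b w) = (\1 + (Z \o b))%VF w.
  by rewrite add_lfunE id_lfunE comp_lfunE.
apply/idP/idP => [/(ker_dirac_exp _ bij)[uK _]|].
  by rewrite fE memv_img.
rewrite fE => /memv_imgP[w wK /(bij_inj bij) ->]; rewrite -fE.
by apply/ker_dirac_exp => //; split=> // k; exact: bK.
Qed.

Lemma same_rank_same_nullity (b b' : bilform V) :
  (\dim (limg b) = \dim (limg b')) <-> (\dim (lker b) = \dim (lker b')).
Proof.
have := limg_ker_dim b fullv; rewrite -(limg_ker_dim b' fullv) !capfv => /eqP h.
by split=> e; move: h; rewrite e ?eqn_add2r ?eqn_add2l => /eqP.
Qed.

(** The shear u |-> u + Z (b u) identifies ker (exp_eta b) with a subspace of K,
    so its dimension is that of K iff it is all of K. *)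
Lemma rank_dirac_exp (b : bilform V) : Idom Z b ->
  skew_rank (\dim (limg eta)) (dirac_exp Z eta b) <-> ker_restr K b.
Proof.
move=> [sb bij]; rewrite ker_restrP.
have /bijective_lfunP f0 := bij.
split=> [[_ /same_rank_same_nullity dE]|[_ bK]]; split=> //; last 2 first.
- exact: dirac_exp_skew.
- apply/same_rank_same_nullity; rewrite ker_dirac_expE // limg_dim_eq ?kerK //.
  by rewrite (eqP f0) capv0.
set f := (\1 + (Z \o b))%VF in bij f0.
have fE w : w + Z (b w) = f w by rewrite add_lfunE id_lfunE comp_lfunE.
set E := lker (dirac_exp Z eta b) in dE.
have iE u : u \in (f^-1 @: E)%VS -> u \in K /\ forall k, k \in K -> b u k = 0.
  move=> /memv_imgP[x xE ->]; apply/ker_dirac_exp => //.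
  by rewrite fE lker0_lfunVK.
have EK : (f^-1 @: E)%VS = K.
  apply/eqP; rewrite eqEdim; apply/andP; split.
    by apply/subvP => u /iE[].
  rewrite kerK -dE limg_dim_eq //; apply/eqP; rewrite -subv0; apply/subvP => u.
  rewrite memv_cap memv_ker => /andP[_ /eqP u0].
  by rewrite -(lker0_lfunVK f0 u) u0 linear0 memv0.
by move=> k k' kK k'K; rewrite -EK in kK; have [_] := iE k kK; exact.
Qed.

(** Since Z eta = - Q, the map id - Z (b - eta) is P - Z b.  Its two terms take
    values in the independent subspaces K and G, so u is in its kernel iff u is
    in G and b(u, -) vanishes on G. *)
Lemma nondegenerate_shear (b : bilform V) :
  bijective (\1 + (- Z \o (b - eta)))%VF <-> nondegenerate_on G b.
Proof.
have E u : u + (- Z)%VF ((b - eta) u) = P u - Z (b u).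
  rewrite (opp_lfunE Z) add_lfunE opp_lfunE linearB /= Z_eta opprK opprD.
  by rewrite {1}(complementary_proj u cKG) addrACA subrr addr0.
split=> [/bijective_lker bij g gG bg|nd].
  by apply: bij; rewrite E complementary_pi0 // Z_eq0 ?subrr.
apply/bijective_lker => u; rewrite E => /eqP; rewrite subr_eq0 => /eqP PZ.
have Pu0 : P u = 0.
  by apply: (complementary_cap0 cKG); rewrite ?memv_pi // PZ.
apply: nd; first by rewrite (complementary_proj u cKG) Pu0 add0r memv_pi.
move=> g gG; apply: oppr_inj.
by rewrite -etaZ // -PZ Pu0 linear0 zero_lfunE oppr0.
Qed.

(** Nondegeneracy on G makes ker b and G independent; the equality of ranks then
    forces their dimensions to add up to that of V. *)
Lemma transverse_nondegenerate (b : bilform V) :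
  skew_rank (\dim (limg eta)) b ->
  complementary (lker b) G <-> nondegenerate_on G b.
Proof.
move=> [sb /same_rank_same_nullity db]; split.
  exact: complement_nondegenerate.
move=> nd.
have cap0 : (lker b :&: G = 0)%VS.
  apply/eqP; rewrite -subv0; apply/subvP => g.
  rewrite memv_cap memv_ker memv0 => /andP[/eqP bg0 gG].
  by apply/eqP; apply: nd => // v _; rewrite bg0 zero_lfunE.
split=> //; apply/eqP; rewrite eqEdim subvf -(cKG.1).
by rewrite (dimv_disjoint_sum cap0) (dimv_disjoint_sum cKG.2) db kerK /= leqnn.
Qed.

Lemma Z_KG mu g : mu \in wedgev (dual_sub K G) (dual_sub G K) -> g \in G ->
  Z (mu g) = 0.
Proof.
by move=> /(KG_vanish cKG)[_ [muG _]] gG; apply: Z_eq0 => h; exact: muG.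
Qed.

(** Z mu vanishes on G since mu vanishes on G x G, and the kernel of
    id + Z sigma lies in G since Z is G-valued; so this kernel is contained in
    that of id + Z (mu + sigma). *)
Lemma Idom_GG (mu sigma : bilform V) :
  mu \in wedgev (dual_sub K G) (dual_sub G K) ->
  sigma \in wedgev (dual_sub G K) (dual_sub G K) ->
  Idom Z (mu + sigma) -> Idom Z sigma.
Proof.
move=> muKG /(GG_vanish cKG)[ss sK] [_ /bijective_lker bij]; split=> //.
apply/bijective_lker => v v0; apply: bij.
have vG : v \in G.
  by rewrite (_ : v = - Z (sigma v)) ?memvN //; apply/eqP; rewrite -addr_eq0 v0.
by rewrite add_lfunE linearD /= Z_KG // add0r.
Qed.

(** As sigma vanishes on K, the shear maps k in K to k + Z (mu k). *)
Lemma lker_KG_GG (mu sigma : bilform V) :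
  mu \in wedgev (dual_sub K G) (dual_sub G K) ->
  sigma \in wedgev (dual_sub G K) (dual_sub G K) ->
  bijective (\1 + (Z \o (mu + sigma)))%VF ->
  [set` lker (dirac_exp Z eta (mu + sigma))] = graph_of K (Z \o mu)%VF.
Proof.
move=> muKG sGG bij.
have [_ sK] := GG_vanish cKG sGG.
have [_ [_ muK]] := KG_vanish cKG muKG.
have fK k : k \in K -> (\1 + (Z \o (mu + sigma)))%VF k = k + (Z \o mu)%VF k.
  by move=> kK; rewrite add_lfunE id_lfunE !comp_lfunE add_lfunE sK // addr0.
rewrite ker_dirac_expE // => [|k k' kK k'K]; last first.
  by rewrite !add_lfunE muK // sK // zero_lfunE addr0.
apply/seteqP; split=> [_ /= /memv_imgP[k kK ->]|_ [k /= kK <-] /=].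
  by exists k => //=; rewrite fK.
by rewrite -fK // memv_img.
Qed.

(** On G the shears of mu + sigma and of sigma agree, and so do these forms. *)
Lemma restr_dirac_exp (mu sigma : bilform V) :
  mu \in wedgev (dual_sub K G) (dual_sub G K) ->
  bijective (\1 + (Z \o (mu + sigma)))%VF -> bijective (\1 + (Z \o sigma))%VF ->
  restr G (dirac_exp Z eta (mu + sigma)) = restr G (eta + Fmap Z sigma).
Proof.
move=> muKG bij bijs; have [_ [muG _]] := KG_vanish cKG muKG.
apply/lfunP => x; apply/lfunP => h; rewrite !restrE /dirac_exp !add_lfunE.
congr (_ + _); have [g xE] := shear_surj (vsval x) bijs.
have gG : g \in G.
  rewrite (_ : g = vsval x - Z (sigma g)) ?memvB ?subvsP //.
  by rewrite xE addrK.
have muE : vsval x = g + Z ((mu + sigma) g).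
  by rewrite add_lfunE linearD /= Z_KG // add0r.
rewrite {1}muE Fmap_apply // xE Fmap_apply //.
by rewrite !add_lfunE muG ?subvsP // add0r.
Qed.

End DiracExponential.

Section Uniqueness.
Set Implicit Arguments.
Unset Strict Implicit.
Variables (R : realType) (V : vectType R).

(** Both forms are unchanged when their arguments are projected onto W along
    the common part U of their kernels. *)
Lemma skew_form_eq (b b' : bilform V) (U W : {vspace V}) :
  skew_form b -> skew_form b' -> complementary U W ->
  (U <= lker b)%VS -> (U <= lker b')%VS -> restr W b = restr W b' -> b = b'.
Proof.
move=> sb sb' cUW /subvP Ub /subvP Ub' eW.
have E (c : bilform V) u v :
    skew_form c -> (forall u, u \in U -> u \in lker c) ->
    c u v = c (daddv_pi W U u) (daddv_pi W U v).
  move=> sc Uc.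
  have c0 w x : c (daddv_pi U W w) x = 0.
    have := Uc _ (memv_pi U W w); rewrite memv_ker => /eqP->.
    by rewrite zero_lfunE.
  rewrite {1}(complementary_proj u cUW) linearD /= add_lfunE c0 add0r.
  rewrite {1}(complementary_proj v cUW) linearD /= [X in X + _]sc c0.
  by rewrite oppr0 add0r.
apply/lfunP => u; apply/lfunP => v; rewrite (E b) // (E b') //.
have := restrE b (Subvs (memv_pi W U u)) (Subvs (memv_pi W U v)).
by rewrite eW restrE.
Qed.

End Uniqueness.

(** * Smoothness of rational maps *)

(** Differentiability and the differential are local. *)
Lemma differentiable_eq_on_open (R : realType) (V W : normedModType R)
    (U : set V) (f g : V -> W) (x : V) :
  open U -> U x -> (forall y, U y -> f y = g y) -> differentiable f x ->
  differentiable g x /\ 'd g x = 'd f x :> (V -> W).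
Proof.
move=> openU Ux fg df.
have [cf ef] := (diff_locallyP _ _).1 df.
have eg : g \o shift x = cst (g x) + 'd f x +o_ 0 id.
  apply/eqaddoP => e e0.
  move/eqaddoP : ef => /(_ e e0) ef.
  have nU : \forall h \near (0 : V), U (h + x).
    have : \forall y \near x, U y by exact: open_nbhs_nbhs.
    by rewrite (near_shift 0 x) /=; apply: filterS => y; rewrite /= subr0.
  near=> h.
  have Uhx : U (h + x) by near: h.
  rewrite !fctE /= -!fg //.
  near: h; exact: ef.
have dE : 'd g x = 'd f x :> (V -> W) by exact: diff_unique.
by split=> //; apply/diff_locallyP; rewrite dE.
Unshelve. all: by end_near. Qed.

Section RationalFunctions.
Set Implicit Arguments.
Unset Strict Implicit.
Variables (R : realType) (n : nat) (U : set 'rV[R]_n).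
Hypothesis openU : open U.

(** The functions on U generated from constants and coordinates by sums,
    products and inverses.  The last constructor makes the class depend only on
    the values on U, which absorbs both the default value of inverses outside
    of U and the fact that derivatives are only computed on U. *)
Inductive rational_on : ('rV[R]_n -> R) -> Prop :=
| rational_cst c : rational_on (fun=> c)
| rational_coord i : rational_on (fun x => x 0 i)
| rational_add f g : rational_on f -> rational_on g ->
    rational_on (fun x => f x + g x)
| rational_mul f g : rational_on f -> rational_on g ->
    rational_on (fun x => f x * g x)
| rational_inv f : rational_on f -> (forall x, U x -> f x != 0) ->
    rational_on (fun x => (f x)^-1)
| rational_ext f g : rational_on f -> (forall x, U x -> g x = f x) ->
    rational_on g.

(** The sum, product and inverse rules express the derivative of a generated
    function by functions of the same class. *)
Lemma rational_differentiable f : rational_on f ->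
  (forall x, U x -> differentiable f x) /\
  forall v, rational_on (fun x => 'd f x v).
Proof.
elim=> {f} [c|i|f g Rf [df Df] Rg [dg Dg]|f g Rf [df Df] Rg [dg Dg]
  |f Rf [df Df] f0|f g Rf [df Df] fg].
- split=> [x _|v]; first exact: differentiable_cst.
  by apply: rational_ext (rational_cst 0) _ => x _; rewrite diff_cst.
- split=> [x _|v]; first exact: differentiable_coord.
  have @c : {linear 'rV[R]_n -> R}.
    by exists (fun N : 'rV[R]_n => N 0 i); do 2![eexists]; do ?[constructor];
     rewrite ?mxE// => ? *; rewrite ?mxE//; move=> ?; rewrite !mxE.
  apply: rational_ext (rational_cst (v 0 i)) _ => x _.
  rewrite (_ : (fun _ => _) = c) // diff_lin //; exact: coord_continuous.
- split=> [x Ux|v].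
    by apply: (@differentiableD _ _ _ f g); [exact: df|exact: dg].
  apply: rational_ext (rational_add (Df v) (Dg v)) _ => x Ux.
  by rewrite (@diffD _ _ _ f g x (df _ Ux) (dg _ Ux)).
- split=> [x Ux|v].
    by apply: (@differentiableM _ _ f g); [exact: df|exact: dg].
  apply: rational_ext (rational_add (rational_mul Rf (Dg v))
    (rational_mul Rg (Df v))) _ => x Ux.
  by rewrite (@diffM _ _ f g x (df _ Ux) (dg _ Ux)).
- split=> [x Ux|v].
    by apply: differentiableV; [exact: df|exact: f0].
  apply: rational_ext (rational_mul (rational_mul (rational_cst (-1))
    (rational_inv (rational_mul Rf Rf) _)) (Df v)) _ => [x Ux|x Ux].
    by rewrite mulf_neq0 ?f0.
  by rewrite (diffV (df _ Ux) (f0 _ Ux)) mulN1r.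
- have H x (Ux : U x) : differentiable g x /\ 'd g x = 'd f x :> (_ -> _).
    apply: differentiable_eq_on_open openU Ux _ (df _ Ux) => y Uy.
    by rewrite fg.
  split=> [x Ux|v]; first by have [] := H x Ux.
  by apply: rational_ext (Df v) _ => x Ux; have [_ ->] := H x Ux.
Qed.

Lemma rational_sum (I : Type) (r : seq I) (P : pred I) F :
  (forall i, P i -> rational_on (F i)) ->
  rational_on (fun x => \sum_(i <- r | P i) F i x).
Proof.
move=> RF; elim: r => [|i r IHr].
  by apply: rational_ext (rational_cst 0) _ => x _; rewrite big_nil.
have [Pi|nPi] := boolP (P i).
  apply: rational_ext (rational_add (RF i Pi) IHr) _ => x _.
  by rewrite big_cons Pi.
by apply: rational_ext IHr _ => x _; rewrite big_cons (negbTE nPi).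
Qed.

Lemma rational_prod (I : Type) (r : seq I) (P : pred I) F :
  (forall i, P i -> rational_on (F i)) ->
  rational_on (fun x => \prod_(i <- r | P i) F i x).
Proof.
move=> RF; elim: r => [|i r IHr].
  by apply: rational_ext (rational_cst 1) _ => x _; rewrite big_nil.
have [Pi|nPi] := boolP (P i).
  apply: rational_ext (rational_mul (RF i Pi) IHr) _ => x _.
  by rewrite big_cons Pi.
by apply: rational_ext IHr _ => x _; rewrite big_cons (negbTE nPi).
Qed.

Definition rational_mx p q (M : 'rV[R]_n -> 'M[R]_(p, q)) :=
  forall i j, rational_on (fun x => M x i j).

Lemma rational_mx_id : rational_mx (fun x => x).
Proof. by move=> i j; rewrite ord1; exact: rational_coord. Qed.

Lemma rational_mx_cst p q (M : 'M[R]_(p, q)) : rational_mx (fun=> M).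
Proof. by move=> i j; exact: rational_cst. Qed.

Lemma rational_mxD p q (M N : 'rV[R]_n -> 'M[R]_(p, q)) :
  rational_mx M -> rational_mx N -> rational_mx (fun x => M x + N x).
Proof.
move=> RM RN i j.
by apply: rational_ext (rational_add (RM i j) (RN i j)) _ => x _; rewrite mxE.
Qed.

Lemma rational_mxM p q r (M : 'rV[R]_n -> 'M[R]_(p, q))
    (N : 'rV[R]_n -> 'M[R]_(q, r)) :
  rational_mx M -> rational_mx N -> rational_mx (fun x => M x *m N x).
Proof.
move=> RM RN i j.
apply: (@rational_ext (fun x => \sum_k M x i k * N x k j)) => [|x _].
  by apply: rational_sum => k _; exact: rational_mul.
by rewrite mxE.
Qed.

Lemma rational_mx_lin p q p' q' (L : 'M[R]_(p, q) -> 'M[R]_(p', q')) M :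
  linear L -> rational_mx M -> rational_mx (fun x => L (M x)).
Proof.
move=> linL RM i j.
pose aux := GRing.isLinear.Build _ _ _ _ _ linL.
pose L' : {linear 'M[R]_(p, q) -> 'M[R]_(p', q')} := HB.pack L aux.
apply: (@rational_ext (fun x => \sum_k \sum_l M x k l * L (delta_mx k l) i j)).
  apply: rational_sum => k _; apply: rational_sum => l _.
  by apply: rational_mul => //; exact: rational_cst.
move=> x _; rewrite {1}[M x]matrix_sum_delta -[L]/(L' : _ -> _).
rewrite linear_sum summxE.
apply: eq_bigr => k _; rewrite linear_sum summxE.
by apply: eq_bigr => l _; rewrite linearZ mxE.
Qed.

Lemma rational_det p (M : 'rV[R]_n -> 'M[R]_p) :
  rational_mx M -> rational_on (fun x => \det (M x)).
Proof.
move=> RM; apply: rational_sum => s _; apply: rational_mul.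
  exact: rational_cst.
by apply: rational_prod => i _.
Qed.

(** By Cramer's rule the entries are cofactors divided by the determinant. *)
Lemma rational_invmx p (M : 'rV[R]_n -> 'M[R]_p) :
  rational_mx M -> (forall x, U x -> M x \in unitmx) ->
  rational_mx (fun x => invmx (M x)).
Proof.
move=> RM uM i j.
have Rc : rational_on (fun x => cofactor (M x) j i).
  apply: rational_mul; first exact: rational_cst.
  apply: rational_det => k l.
  by apply: rational_ext (RM (lift j k) (lift i l)) _ => x _; rewrite !mxE.
apply: rational_ext
  (rational_mul (rational_inv (rational_det RM) _) Rc) _ => x Ux.
  by have := uM x Ux; rewrite unitmxE unitfE.
by rewrite /invmx uM // !mxE.
Qed.

(** By induction on k, as the directional derivatives are again rational. *)
Lemma rational_mx_Ck m (f : 'rV[R]_n -> 'rV[R]_m) k :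
  rational_mx f -> Ck k U f.
Proof.
have df (g : 'rV[R]_n -> 'rV[R]_m) :
    rational_mx g -> forall x, U x -> differentiable g x.
  move=> Rg x Ux.
  have -> : g = \sum_(i < m) (fun x => g x 0 i *: delta_mx 0 i).
    apply/funext => y; rewrite fct_sumE.
    exact: row_sum_delta.
  apply: differentiable_sum => i; apply: differentiableZl.
  exact: (rational_differentiable (Rg 0 i)).1.
elim: k f => [|k IHk] f Rf /=.
  by move=> x Ux; apply: differentiable_continuous; exact: df.
split=> [|v]; first exact: df.
apply: IHk => i j.
apply: rational_ext ((rational_differentiable (Rf i j)).2 v) _ => x Ux.
have dfx := df _ Rf _ Ux.
rewrite -deriveE // derive_mx ?mxE; last exact: diff_derivable.
rewrite deriveE //; exact: (rational_differentiable (Rf i j)).1.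
Qed.

End RationalFunctions.

Section SmoothnessOfFmap.
Set Implicit Arguments.
Unset Strict Implicit.
Variables (R : realType) (V : vectType R).

(** Turns the inverse of a linear map into the inverse of a matrix, to which
    Cramer's rule applies. *)
Lemma mxof_inv (f : 'Hom(V, V)) (e := vbasis {:V}) : bijective f ->
  passmx.mxof e e f \in unitmx /\
  passmx.mxof e e (f^-1)%VF = invmx (passmx.mxof e e f).
Proof.
move/bijective_lfunP => f0; have eB : basis_of {:V} e := vbasisP _.
have M1 : passmx.mxof e e f *m passmx.mxof e e (f^-1)%VF = 1%:M.
  rewrite -(passmx.mxof_comp _ _ eB) lker0_compVf //.
  by rewrite passmx.mxof1 ?(basis_free eB).
have [uM _] := mulmx1_unit M1.
by split=> //; rewrite -[RHS]mulmx1 -M1 mulKmx.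
Qed.

Lemma bijective_unitmx (f : 'Hom(V, V)) (e := vbasis {:V}) :
  bijective f <-> passmx.mxof e e f \in unitmx.
Proof.
split=> [/mxof_inv[]//|uM]; have eB : basis_of {:V} e := vbasisP _.
have M1 : (passmx.hommx e e (invmx (passmx.mxof e e f)) \o f)%VF = \1%VF.
  apply: (can_inj (passmx.mxofK eB eB)).
  rewrite (passmx.mxof_comp _ _ eB) passmx.hommxK // mulmxV //.
  by rewrite passmx.mxof1 ?(basis_free eB).
apply/bijective_lfunP/lker0P => u v fuv.
by rewrite -[u]id_lfunE -[v]id_lfunE -M1 !comp_lfunE fuv.
Qed.

Lemma coords_image (E : vectType R) (D : set E) :
  @coords R E @` D = @of_coords R E @^-1` D.
Proof.
have eB : basis_of {:E} (vbasis {:E}) := vbasisP _.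
apply/seteqP; split=> [_ [b Db <-]|x Dx] /=.
  by rewrite /of_coords /coords passmx.rVofK.
by exists (of_coords x) => //; rewrite /of_coords /coords passmx.vecofK.
Qed.

Lemma coordsD (E : vectType R) (a b : E) : coords (a + b) = coords a + coords b.
Proof. by have := passmx.rVof_linear (vbasis {:E}) 1 a b; rewrite !scale1r. Qed.

Lemma mxofD (W : vectType R) e (e' : (\dim {:W}).-tuple W) (f g : 'Hom(V, W)) :
  passmx.mxof e e' (f + g) = passmx.mxof e e' f + passmx.mxof e e' g.
Proof. by have := passmx.mxof_linear e e' 1 f g; rewrite !scale1r. Qed.

Lemma mxofB (W : vectType R) e (e' : (\dim {:W}).-tuple W) (f g : 'Hom(V, W)) :
  passmx.mxof e e' (f - g) = passmx.mxof e e' f - passmx.mxof e e' g.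
Proof.
have := passmx.mxof_linear e e' (-1) g f.
by rewrite !scaleN1r ![- _ + _]addrC.
Qed.

(** Covers exp_eta (c = 0, d = eta) as well as its inverse (c = eta, d = 0, with
    - Z in place of Z).  The domain is the complement of the zero set of
    the determinant of id + Z (b - c). *)
Lemma Fmap_translate_smooth (Z : 'Hom(dual V, V)) (c d : bilform V) :
  let D := [set b : bilform V | bijective (\1 + (Z \o (b - c)))%VF] in
  vopen D /\ smooth_open D (fun b => d + Fmap Z (b - c)).
Proof.
move=> D; rewrite /vopen /smooth_open coords_image.
set n := \dim {:bilform V}; set U := @of_coords _ _ @^-1` D.
pose e := vbasis {:V}; pose e' := vbasis {:dual V}.
have eB : basis_of {:V} e := vbasisP _.
have eB' : basis_of {:dual V} e' := vbasisP _.
(* M and N are the matrices of id + Z (b - c) and b - c, where b has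
   coordinates x. *)
pose N (x : 'rV[R]_n) := passmx.mxof e e' (of_coords x - c).
pose M (x : 'rV[R]_n) := passmx.mxof e e (\1 + (Z \o (of_coords x - c)))%VF.
have RN A : rational_mx A N.
  have -> : N = fun x => passmx.mxof e e' (of_coords x) + - passmx.mxof e e' c.
    by apply/funext => x; rewrite -mxofB.
  apply: rational_mxD; last exact: rational_mx_cst.
  apply: (@rational_mx_lin _ _ _ _ _ _ _
    (fun x => passmx.mxof e e' (of_coords x))); last exact: rational_mx_id.
  move=> a u v.
  by rewrite /of_coords passmx.vecof_linear; exact: passmx.mxof_linear.
have RM A : rational_mx A M.
  have -> : M = fun x => 1%:M + N x *m passmx.mxof e' e Z.
    apply/funext => x; rewrite /M mxofD.
    by rewrite passmx.mxof1 ?(basis_free eB) // (passmx.mxof_comp _ _ eB').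
  apply: rational_mxD; first exact: rational_mx_cst.
  by apply: rational_mxM; [exact: RN|exact: rational_mx_cst].
have UE : U = (fun x => \det (M x)) @^-1` [set y | y != 0].
  apply/seteqP; split=> x /=; rewrite /U /D /=.
    by move/bijective_unitmx; rewrite unitmxE unitfE.
  by move=> Mx; apply/bijective_unitmx; rewrite unitmxE unitfE.
have oU : open U.
  rewrite UE; apply: open_comp; last exact: open_neq.
  move=> x _; apply: differentiable_continuous.
  have RD := rational_det (RM setT).
  exact: (rational_differentiable openT RD).1.
split=> // k; apply: rational_mx_Ck => //.
have RF : rational_mx U (fun x => coords d +
    coords (passmx.hommx e e' (invmx (M x) *m N x) : bilform V)).
  apply: rational_mxD; first exact: rational_mx_cst.
  apply: (@rational_mx_lin _ _ _ _ _ _ _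
    (fun A => coords (passmx.hommx e e' A : bilform V))).
    move=> a A B; rewrite -passmx.rVof_linear; congr coords.
    exact: passmx.hommx_linear.
  apply: rational_mxM; last exact: RN.
  apply: rational_invmx; first exact: RM.
  by move=> x /bijective_unitmx.
move=> i j; apply: rational_ext (RF i j) _ => x Ux.
congr (fun A : 'rV_n => A i j) => /=; rewrite coordsD; congr (_ + coords _).
apply: (can_inj (passmx.mxofK eB eB')); rewrite passmx.hommxK // /Fmap.
by rewrite (passmx.mxof_comp _ _ eB) (mxof_inv Ux).2.
Qed.

End SmoothnessOfFmap.

(** * The theorem *)

Theorem theorem2p6 (R : realType) (V : vectType R) (k : nat)
    (eta : bilform V) (heta : skew_rank k eta)
    (K : {vspace V}) (hK : K = lker eta)
    (G : {vspace V}) (hG : complementary K G)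
    (Z : 'Hom(dual V, V)) (hZ : Z = bivector_incl (- (restr G eta)^-1%VF))
    (KG : {vspace bilform V}) (hKG : KG = wedgev (dual_sub K G) (dual_sub G K))
    (GG : {vspace bilform V}) (hGG : GG = wedgev (dual_sub G K) (dual_sub G K)) :
  [/\ ker_restr K = [set` (KG + GG)%VS] /\ directv (KG + GG),
      forall beta, Idom Z beta ->
        (skew_rank k (dirac_exp Z eta beta) <-> ker_restr K beta),
      forall mu sigma, mu \in KG -> sigma \in GG -> Idom Z (mu + sigma) ->
        Idom Z sigma /\
        unique (fun omega : bilform V =>
          [/\ skew_form omega,
              restr G omega = restr G (eta + Fmap Z sigma) &
              [set` lker omega] = graph_of K (Z \o mu)%VF])
          (dirac_exp Z eta (mu + sigma)) &
      let target := [set eta' | skew_rank k eta' /\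
                                complementary (lker eta') G] in
      diffeomorphism (Idom Z `&` [set` (KG + GG)%VS]) target (dirac_exp Z eta) /\
      (target eta /\
       exists2 U : set (bilform V), vopen U & target = skew_rank k `&` U)].
Proof.
have [sketa rketa] := heta.
have [ZG etaZ] := bivector_of_restr sketa hK hG hZ.
have sZ := Z_skew sketa ZG etaZ.
have rankP b : Idom Z b -> skew_rank k (dirac_exp Z eta b) <-> ker_restr K b.
  by rewrite -rketa => Ib; exact: (rank_dirac_exp sketa hK hG ZG etaZ Ib).
have kerE : ker_restr K = [set` (KG + GG)%VS].
  by rewrite hKG hGG; exact: ker_restr_KG_GG.
pose D : set (bilform V) := [set b | bijective (\1 + (- Z \o (b - eta)))%VF].
have transP b : skew_rank k b -> complementary (lker b) G <-> D b.
  move=> rb; rewrite /D /= (nondegenerate_shear sketa hK hG ZG etaZ).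
  by apply: (transverse_nondegenerate hK hG); rewrite rketa.
have exp_inverse b : Idom Z b -> D (dirac_exp Z eta b) /\
    Fmap (- Z) (dirac_exp Z eta b - eta) = b.
  move=> [_ bij]; have [] := Fmap_inverse bij.
  by rewrite /D /= /dirac_exp [eta + _]addrC addrK.
have inverse_exp b : D b -> bijective (\1 + (Z \o Fmap (- Z) (b - eta)))%VF /\
    dirac_exp Z eta (Fmap (- Z) (b - eta)) = b.
  move=> /Fmap_inverse; rewrite opprK => -[bij bE]; split=> //.
  by rewrite /dirac_exp bE addrC subrK.
split=> //.
- by split=> //; rewrite hKG hGG; exact: directv_KG_GG.
- move=> mu sigma; rewrite hKG hGG => muKG sGG I.
  have Is : Idom Z sigma by apply: Idom_GG muKG sGG I.
  have kE := lker_KG_GG sketa hK hG etaZ muKG sGG I.2.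
  have rE := restr_dirac_exp sketa hK hG ZG etaZ muKG I.2 Is.2.
  have se := dirac_exp_skew sketa ZG etaZ I.
  split=> //; split=> // omega [so ro ko].
  have rkE : skew_rank k (dirac_exp Z eta (mu + sigma)).
    by apply/rankP => //; rewrite kerE hKG hGG /=; exact: memv_add.
  have cE : complementary (lker (dirac_exp Z eta (mu + sigma))) G.
    by apply/transP => //; have [] := exp_inverse _ I.
  apply: (skew_form_eq se so cE (subvv _)); last by rewrite ro.
  by apply/subvP => x xE; suff : [set` lker omega] x by []; rewrite ko -kE.
move=> target.
have targetE : target = skew_rank k `&` D.
  by apply/seteqP; split=> b [rb H]; split=> //; apply/transP.
have [openD smD] := Fmap_translate_smooth (- Z) eta 0.
have [openI smI] := Fmap_translate_smooth Z 0 eta.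
split; last by split; [split=> //; rewrite -hK|exists D].
split.
- split.
  + move=> b [Ib bK]; rewrite targetE; split.
      by apply/rankP => //; rewrite kerE.
    by have [] := exp_inverse b Ib.
  + move=> b b'; rewrite !inE => -[Ib _] [Ib' _] e.
    have [_ <-] := exp_inverse b Ib; have [_ <-] := exp_inverse b' Ib'.
    by rewrite e.
  + move=> b tb; have [rb Db] : (skew_rank k `&` D) b by rewrite -targetE.
    have [bij bE] := inverse_exp b Db.
    have Ib : Idom Z (Fmap (- Z) (b - eta)).
      split=> //; apply: Fmap_skew => //.
        by move=> xi zeta; rewrite !(opp_lfunE Z) !linearN /= sZ.
      by move=> u v; rewrite !add_lfunE !opp_lfunE rb.1 sketa -opprD.
    exists (Fmap (- Z) (b - eta)) => //; split=> //.
    by rewrite -kerE; apply/rankP => //; rewrite bE.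
- move=> b [[sb bij] bK].
  exists [set b | bijective (\1 + (Z \o (b - 0)))%VF],
    (fun b => eta + Fmap Z (b - 0)).
  by split=> //= [|y _ _]; rewrite subr0.
exists (fun b => 0 + Fmap (- Z) (b - eta)).
  by move=> b [Ib bK]; rewrite add0r; have [] := exp_inverse b Ib.
move=> b; rewrite targetE => -[rb Db].
by exists D, (fun b => 0 + Fmap (- Z) (b - eta)).
Qed.
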